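(* There are infinitely many finite fields $\mathbb{F}_q$ for which $$M(q)\ge\tfrac12(\log q)^2.$$
   Context: A set of polynomials $f_1,\ldots,f_r$ of positive degree over a finite field $\mathbb{F}_q$ is called dynamically-irreducible if all polynomials formed by composition of $f_1,\ldots,f_r$, i.e. all $f_{i_1}\circ f_{i_2}\circ\cdots\circ f_{i_n}$ with $n\ge 1$ and $i_1,\ldots,i_n\in\{1,\ldots,r\}$ (repetitions allowed), are irreducible over $\mathbb{F}_q$. For a prime power $q$, $M(q)$ denotes the maximal size of a set of (distinct) monic quadratic polynomials over $\mathbb{F}_q$ which is dynamically-irreducible. Here $\log$ is the natural logarithm. *)

(* Defs.v *)
From HB Require Import structures.
From mathcomp Require Import all_boot all_order all_algebra finmap.
From mathcomp Require Import all_classical all_reals all_analysis.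

Set Implicit Arguments.
Unset Strict Implicit.
Unset Printing Implicit Defensive.

Import Order.TTheory GRing.Theory Num.Theory.

Local Open Scope ring_scope.

(* [:: f_1; ...; f_n] is sent to f_1 \Po (f_2 \Po ... (f_n \Po 'X)),
   where (p \Po q).[x] = p.[q.[x]]. *)
Definition composition (F : fieldType) (fs : seq {poly F}) : {poly F} :=
  foldr (fun f g => f \Po g) 'X fs.

Definition dynamically_irreducible (F : fieldType) (S : {fset {poly F}}) : Prop :=
  (forall f, f \in S -> (1 < size f)%N) /\
  (forall fs : seq {poly F}, fs != [::] -> {subset fs <= S} ->
     irreducible_poly (composition fs)).

Definition monic_quadratic (F : fieldType) (f : {poly F}) : bool :=
  (f \is monic) && (size f == 3).

Definition dyn_irred_size (F : finFieldType) (n : nat) : Prop :=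
  exists S : {fset {poly F}},
    [/\ forall f, f \in S -> monic_quadratic f,
        dynamically_irreducible S
      & #|` S| = n].

Lemma dyn_irred_size_ex (F : finFieldType) : exists n, `[< dyn_irred_size F n >].
Proof.
exists 0%N; apply/asboolP; exists fset0; split=> //.
split=> // -[|f fs] // _ sub.
by have := sub f (mem_head _ _); rewrite inE.
Qed.

Lemma dyn_irred_size_le (F : finFieldType) (n : nat) :
  `[< dyn_irred_size F n >] -> (n <= #|F| * #|F|)%N.
Proof.
move=> /asboolP[S [quadS _ <-]].
pose c (f : {poly F}) := (f`_0, f`_1).
have c_inj : {in enum_fset S &, injective c}.
  move=> f g /quadS/andP[mf /eqP sf] /quadS/andP[mg /eqP sg] [c0 c1].
  apply/polyP=> -[|[|[|i]]] //; last by rewrite !nth_default ?sf ?sg.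
  by move: mf mg; rewrite !monicE !lead_coefE sf sg => /eqP -> /eqP ->.
rewrite -card_prod -(size_map c); rewrite cardE; apply: uniq_leq_size => [|x _]; last by rewrite mem_enum.
by rewrite map_inj_in_uniq ?fset_uniq.
Qed.

(* M(q) for F of order q; finite fields of equal order are isomorphic, so the
   value depends on #|F| alone. *)
Definition M (F : finFieldType) : nat :=
  ex_maxn (dyn_irred_size_ex F) (@dyn_irred_size_le F).

(* Main.v *)
Require Import Defs.
From mathcomp Require Import all_boot all_order all_algebra finmap.
From mathcomp Require Import all_classical all_reals all_analysis.
From mathcomp Require Import finfield ring lra zify.

(** Let [p] be a large odd prime, [s = p ^ k], and let [F] be a field with
[q = s ^ 2] elements. Suppose that [c] in [F] is such that every translate
[c + i], with [i] in the prime field, is a nonsquare. Then the [p ^ 2] quadratics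
[(X - c + i)^2 + c + j], with [i] and [j] in the prime field, form a dynamically
irreducible set. Indeed all of them map the set [T] of translates of [c] into
itself, and, by a criterion of Capelli type ([irreducible_comp_X2]), if [G] is
monic and irreducible then so is [G] composed with [(X + a)^2 + e] as soon as
[(-1) ^ deg G * G(e)] is a nonsquare. As [q] is 1 modulo 4, signs do not matter,
and [G(e)] belongs to [T] when [e] does and [G] is a composition of the given
quadratics ([composition_irreducible], [le_M_nonsquare_translates]).

Such a [c] exists when [s] is at least [5 p 2 ^ p]
([exists_translates_legendreN1]). With [chi] the quadratic character of [F],
expand the sum over [x] of the product over [i] of [1 - chi(x + i)] into sums of
[chi] along products of distinct linear factors. The empty product contributes
[q], and each of the other [2 ^ p - 1] terms is [O(p s)]. This Weil type bound
([legendre_sum_le]) is obtained by the polynomial method, in a form due to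
Stepanov and Bombieri. Put [t = (s - 1) / 2], so that
[(q - 1) / 2 = t (s + 1)], and let [h] have degree [d] and satisfy [h(0) <> 0].
Consider the polynomials

  [P = sum_j X^(j s) (b_j + a_j h^t)]

with [a_j] and [b_j] of degree less than [t - d]. At a point [x] of [F] with
[h(x)^((q - 1) / 2) = e], the number [y = h(x)^t] satisfies [y * y^s = e], and
[x^(s^2) = x], so that [P(x)^s * y] is the value at [x] of a polynomial of small
degree whose coefficients depend linearly on the [s]-th powers of those of the
[a_j] and [b_j]. Counting parameters gives a nontrivial choice for which this
polynomial vanishes identically. Then [P] vanishes at all such [x], and it is not
zero when [h] is not a constant multiple of a square ([stepanov_sum_neq0]): look
at the lowest nonzero term modulo [X^s]. Hence the number of these [x] is at most
the degree of [P], which is [q / 2 + O(d s)].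

Finally, taking the least [k] with [p ^ k >= 5 p 2 ^ p] gives
[s < 5 p^2 2 ^ p], and then [ln q = 2 ln s] is at most [sqrt 2 * p], because
[2 ln 2 < sqrt 2]. So [p ^ 2] is at least [(ln q)^2 / 2] for large [p]. *)

Set Implicit Arguments.
Unset Strict Implicit.
Unset Printing Implicit Defensive.

Import Order.TTheory GRing.Theory Num.Theory.

Local Open Scope ring_scope.

(** * Irreducibility of compositions with a quadratic polynomial *)

Lemma size_comp_X2 (F : fieldType) (p : {poly F}) :
  p != 0 -> size (p \Po 'X^2) = ((size p).-1 * 2).+1.
Proof.
move=> p0; have Lp : p \Po 'X^2 != 0 by rewrite comp_poly_eq0 // size_polyXn.
by rewrite [LHS]polySpred // size_comp_poly size_polyXn.
Qed.

Lemma comp_X2_inj (F : fieldType) : injective (fun p : {poly F} => p \Po 'X^2).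
Proof.
move=> p q /eqP; rewrite -subr_eq0 -comp_polyB.
by rewrite comp_poly_eq0 ?size_polyXn // subr_eq0 => /eqP.
Qed.

(** The norm of [q] from [F[X]] down to [F[X^2]], with [X^2] renamed to ['X]. *)
Definition even_norm (F : fieldType) (q : {poly F}) : {poly F} :=
  even_poly q ^+ 2 - 'X * odd_poly q ^+ 2.

Lemma even_normE (F : fieldType) (q : {poly F}) :
  even_norm q \Po 'X^2 = q * (q \Po - 'X).
Proof.
have def_q := esym (poly_even_odd q).
have -> : q \Po - 'X = even_poly q \Po 'X^2 - (odd_poly q \Po 'X^2) * 'X.
  rewrite {1}def_q comp_polyD comp_polyM -!comp_polyA comp_polyX comp_Xn_poly.
  by rewrite sqrrN mulrN.
rewrite {2}def_q /even_norm comp_polyB !expr2 !comp_polyM comp_polyX.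
by ring.
Qed.

Lemma size_even_norm (F : fieldType) (q : {poly F}) :
  q != 0 -> size (even_norm q) = size q.
Proof.
move=> q0; have sX : size (- 'X : {poly F}) = 2%N by rewrite size_polyN size_polyX.
have N0 : even_norm q \Po 'X^2 != 0 by rewrite even_normE mulf_neq0 // comp_poly2_eq0.
have n0 : even_norm q != 0 by rewrite comp_poly_eq0 ?size_polyXn // in N0.
have := size_comp_X2 n0; rewrite even_normE size_mul ?comp_poly2_eq0 //.
rewrite size_comp_poly2 //.
rewrite -size_poly_gt0 in q0; rewrite -size_poly_gt0 in n0.
by move: (size q) (size (even_norm q)) q0 n0 => a b; lia.
Qed.

Lemma lead_coef_even_norm (F : fieldType) (q : {poly F}) :
  lead_coef (even_norm q) = (-1) ^+ (size q).-1 * lead_coef q ^+ 2.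
Proof.
have := congr1 lead_coef (even_normE q).
rewrite lead_coef_comp ?size_polyXn // lead_coefXn expr1n mulr1 => ->.
rewrite lead_coefM lead_coef_comp ?size_polyN ?size_polyX //.
by rewrite lead_coefN lead_coefX mulrA -expr2 mulrC.
Qed.

Lemma horner0_even_norm (F : fieldType) (q : {poly F}) :
  (even_norm q).[0] = q.[0] ^+ 2.
Proof.
have := congr1 (horner^~ 0) (even_normE q).
by rewrite /= hornerM !horner_comp hornerXn hornerN hornerX oppr0 expr0n => ->.
Qed.

(** If [q] divides [K(X^2)], its norm divides the norm [K ^ 2] of [K(X^2)], so it
is associate to [1], [K] or [K ^ 2]. The first and last cases make [q] a trivial
divisor. In the second one, comparing constant and leading coefficients exhibits
[(-1) ^ deg K * K(0)] as a square. *)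
Lemma irreducible_comp_X2 (F : fieldType) (K : {poly F}) :
  K \is monic -> irreducible_poly K ->
  (forall y, (-1) ^+ (size K).-1 * K.[0] != y ^+ 2) ->
  irreducible_poly (K \Po 'X^2).
Proof.
move=> mK irrK nsq; have [sK _] := irrK; have K0 := monic_neq0 mK.
split; first by rewrite size_comp_X2 //; move: (size K) sK => n; lia.
move=> q sq /dvdpP[w Lwq].
have L0 : K \Po 'X^2 != 0 by rewrite comp_poly_eq0 ?size_polyXn.
have /andP[w0 q0] : (w != 0) && (q != 0).
  by rewrite -negb_or -mulf_eq0 -Lwq.
have NN : even_norm w * even_norm q = K ^+ 2.
  have Lwq' : (w \Po - 'X) * (q \Po - 'X) = K \Po 'X^2.
    by rewrite -comp_polyM -Lwq -comp_polyA comp_Xn_poly sqrrN.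
  apply: comp_X2_inj; rewrite /= expr2 !comp_polyM !even_normE mulrACA.
  by rewrite -Lwq Lwq'.
have Nq0 : even_norm q != 0 by rewrite -size_poly_gt0 size_even_norm ?size_poly_gt0.
have [cop|] := boolP (coprimep (even_norm q) K).
  have : even_norm q %| K ^+ 2 by rewrite -NN dvdp_mull.
  rewrite -[K ^+ 2]mulr1 Gauss_dvdpr ?coprimep_expr // dvdp1 size_even_norm //.
  by rewrite (negPf sq).
rewrite /coprimep => /irrK/(_ (dvdp_gcdr _ _)) KD.
have : K %| even_norm q by rewrite -(eqp_dvdl _ KD) dvdp_gcdl.
case/dvdpP=> M NqM.
have KM : K = even_norm w * M.
  by apply: (mulIf K0); rewrite -expr2 -NN NqM mulrA.
have M0 : M != 0 by apply: contraNneq Nq0 => M0; rewrite NqM M0 mul0r.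
have [sM|sM] := eqVneq (size M) 1%N; last first.
  have /irrK := sM; rewrite {1}KM dvdp_mull // => /(_ isT) /eqp_size sMK.
  rewrite -dvdp_size_eqp ?Lwq ?dvdp_mull // -Lwq size_comp_X2 //.
  rewrite -(size_even_norm q0) NqM size_mul // sMK.
  by move: (size K) sK => n; lia.
(* The norm of [q] is the constant multiple [m *: K] of [K]. *)
have /size_poly1P[m m0 Mm] : size M == 1%N by rewrite sM.
have sqK : size q = size K.
  by rewrite -(size_even_norm q0) NqM Mm mul_polyC size_scale.
have lm : m = (-1) ^+ (size K).-1 * lead_coef q ^+ 2.
  rewrite -sqK -lead_coef_even_norm NqM Mm lead_coefM lead_coefC.
  by rewrite (monicP mK) mulr1.
have l0 : lead_coef q != 0 by rewrite lead_coef_eq0.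
have := horner0_even_norm q; rewrite NqM Mm hornerM hornerC lm => h0.
case/eqP: (nsq (q.[0] / lead_coef q)).
by rewrite expr_div_n -h0; field.
Qed.

Lemma irreducible_comp_XaddC (F : fieldType) (K : {poly F}) (a : F) :
  irreducible_poly K -> irreducible_poly (K \Po ('X + a%:P)).
Proof.
move=> [sK irrK]; have sX : size ('X + a%:P : {poly F}) = 2 by rewrite size_XaddC.
split=> [|q sq qK]; first by rewrite size_comp_poly2.
have qE : q = (q \Po ('X - a%:P)) \Po ('X + a%:P).
  by rewrite -{1}(comp_polyXaddC_K q (- a)) polyCN opprK.
rewrite qE; apply/andP; split; apply: dvdp_comp_poly.
  by rewrite -(comp_polyXaddC_K K a); exact: dvdp_comp_poly.
have /irrK : size (q \Po ('X - a%:P)) != 1%N by rewrite size_comp_poly2 ?size_XsubC.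
have : q \Po ('X - a%:P) %| K.
  by rewrite -(comp_polyXaddC_K K a); exact: dvdp_comp_poly.
by move=> -> // /(_ isT) /andP[].
Qed.

(** * Dynamically irreducible sets from nonsquare translates *)

Lemma composition_rcons (F : fieldType) (fs : seq {poly F}) (f : {poly F}) :
  composition (rcons fs f) = composition fs \Po f.
Proof.
rewrite /composition; elim: fs => [|g fs IHfs] /=.
  by rewrite comp_polyX comp_polyXr.
by rewrite IHfs comp_polyA.
Qed.

(** [T] is a set of values stable under [S] and containing the constant terms of
the quadratics in [S]. The sign [(-1) ^+ n] absorbs the parity of the degree of
the composition. The empty composition ['X] serves as the base case. *)
Lemma composition_irreducible (F : fieldType) (T : F -> Prop)
    (S : {fset {poly F}}) :
  (forall z, T z -> forall n y, (-1) ^+ n * z != y ^+ 2) ->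
  (forall f, f \in S -> exists a e, f = ('X + a%:P) ^+ 2 + e%:P /\ T e) ->
  (forall f z, f \in S -> T z -> T f.[z]) ->
  forall fs : seq {poly F}, {subset fs <= S} ->
    [/\ composition fs \is monic, irreducible_poly (composition fs)
      & forall z, T z -> T (composition fs).[z]].
Proof.
move=> nsqT shapeS stabS; elim/last_ind => [|fs f IHfs] sub.
  rewrite /composition /=; split; first exact: monicX.
    by rewrite -['X]addr0 -polyC0; exact: irredp_XaddC.
  by move=> z; rewrite hornerX.
have fS : f \in S by apply: sub; rewrite mem_rcons mem_head.
have [g gfs|mG irrG stabG] := IHfs.
  by apply: sub; rewrite mem_rcons inE gfs orbT.
have [a [e [def_f Te]]] := shapeS f fS.
rewrite composition_rcons.
have monic_comp (g h : {poly F}) :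
    g \is monic -> h \is monic -> (1 < size h)%N -> g \Po h \is monic.
  move=> mg mh sh; rewrite monicE lead_coef_comp // (monicP mg) (monicP mh).
  by rewrite expr1n mulr1.
(* Write [f] as [('X + e) o 'X^2 o ('X + a)]. *)
have -> : composition fs \Po f =
    ((composition fs \Po ('X + e%:P)) \Po 'X^2) \Po ('X + a%:P).
  rewrite def_f -!comp_polyA; congr (_ \Po _).
  by rewrite comp_polyD comp_polyX comp_polyC comp_Xn_poly.
have mGe : composition fs \Po ('X + e%:P) \is monic.
  by rewrite monic_comp ?monicXaddC ?size_XaddC.
split.
- by rewrite !monic_comp ?monicXaddC ?monicXn ?size_XaddC ?size_polyXn.
- apply: irreducible_comp_XaddC; apply: irreducible_comp_X2 => //.
    exact: irreducible_comp_XaddC.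
  move=> y; rewrite horner_comp !hornerE; apply: nsqT; exact: stabG.
- move=> z Tz; rewrite -comp_polyA -comp_polyA horner_comp; apply: stabG.
  suff -> : (('X + e%:P) \Po ('X^2 \Po ('X + a%:P))).[z] = f.[z] by exact: stabS.
  by rewrite def_f !horner_comp !hornerE.
Qed.

Lemma natr_inj_pchar (R : nzRingType) (p i j : nat) :
  p \in [pchar R] -> (i < p)%N -> (j < p)%N -> i%:R = j%:R :> R -> i = j.
Proof.
move=> charp; wlog le_ij : i j / (i <= j)%N.
  by move=> IH ip jp eq_ij; case/orP: (leq_total i j) => le; [|symmetry]; apply: IH.
move=> ip jp /esym/eqP; rewrite -subr_eq0 -natrB // -(dvdn_pcharf charp).
have [/eqP|ji /dvdn_leq] := posnP (j - i)%N; first by rewrite subn_eq0; lia.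
by move/(_ ji); lia.
Qed.

Lemma le_M_nonsquare_translates (F : finFieldType) (p : nat) (c : F) :
  p \in [pchar F] -> odd p ->
  (forall i n : nat, forall y, (-1) ^+ n * (c + i%:R) != y ^+ 2) ->
  (p ^ 2 <= M F)%N.
Proof.
move=> charp oddp nsq.
(* With this sign of [ij.1], [quad ij] sends [c + n] to [c + ((n + i)^2 + j)], so
   that all the translates in play are by natural numbers. *)
pose quad (ij : 'I_p * 'I_p) : {poly F} :=
  ('X + (ij.1%:R - c)%:P) ^+ 2 + (c + ij.2%:R)%:P.
have quadE ij n : (quad ij).[c + n%:R] = c + ((n + ij.1) ^ 2 + ij.2)%:R.
  by rewrite /quad hornerD horner_exp hornerD hornerX !hornerC !natrD natrX natrD; ring.
have two0 : 2%:R != 0 :> F.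
  rewrite -(dvdn_pcharf charp) dvdn_prime2 ?(pcharf_prime charp) //.
  by apply: contraL oddp => /eqP->.
have quad_inj : injective quad.
  move=> [i j] [i' j'] eq_q.
  have := congr1 (horner^~ (c + 0%:R)) eq_q; rewrite /= !quadE /= !add0n.
  have := congr1 (horner^~ (c + 1%:R)) eq_q; rewrite /= !quadE /=.
  rewrite !natrD !natrX !natrD => e1 e0.
  (* The values of [quad (i, j)] at [c + 1] and [c] differ by [2 i + 1]. *)
  have twoE (u v : F) : 2%:R * u = (c + ((1%:R + u) ^+ 2 + v)) - (c + (u ^+ 2 + v)) - 1.
    by ring.
  have /(mulfI two0) ei : 2%:R * i%:R = 2%:R * i'%:R :> F.
    by rewrite (twoE _ j%:R) e1 e0 -twoE.
  have ej : j%:R = j'%:R :> F by move: e0; rewrite ei => /addrI/addrI.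
  have -> : i = i' by apply: val_inj; exact: (natr_inj_pchar charp (ltn_ord i) (ltn_ord i')).
  by have -> : j = j' by apply: val_inj; exact: (natr_inj_pchar charp (ltn_ord j) (ltn_ord j')).
pose S := [fset quad ij | ij : 'I_p * 'I_p]%fset.
have shapeS f : f \in S -> exists ij, f = quad ij.
  by case/imfsetP => ij _ ->; exists ij.
pose T z := exists n : nat, z = c + n%:R.
suff dynS : dyn_irred_size F (p ^ 2).
  rewrite /M; case: ex_maxnP => m _; apply; exact/asboolP.
exists S; split.
- move=> f /shapeS[ij ->]; rewrite /monic_quadratic /quad.
  have sq : size (('X + (ij.1%:R - c)%:P) ^+ 2 : {poly F}) = 3.
    by rewrite -[_%:P]opprK -polyCN size_exp_XsubC.
  have lt : (size (c + ij.2%:R)%:P < size (('X + (ij.1%:R - c)%:P) ^+ 2))%N.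
    by rewrite sq (leq_ltn_trans (size_polyC_leq1 _)).
  by rewrite size_polyDl // sq eqxx andbT monicE lead_coefDl // -monicE monic_exp ?monicXaddC.
- have irrS fs : {subset fs <= S} -> irreducible_poly (composition fs).
    case/(@composition_irreducible F T S) => //.
    + by move=> z [n ->] m y; apply: nsq.
    + move=> f /shapeS[ij ->]; exists (ij.1%:R - c), (c + ij.2%:R).
      by split=> //; exists ij.2.
    + by move=> f z /shapeS[ij ->] [n ->]; rewrite quadE; eexists.
  split=> [f fS|fs _ sub]; last exact: irrS.
  have [|] := irrS [:: f].
    by move=> g; rewrite inE => /eqP->.
  by rewrite /composition /= comp_polyXr.
- by rewrite card_imfset //= -cardE card_prod !card_ord.
Qed.

(** * The polynomial method for the quadratic character *)

Lemma exists_poly_dependence (F : fieldType) (I : finType)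
    (Q : I -> {poly F}) (n : nat) :
  (forall i, (size (Q i) <= n)%N) -> (n < #|I|)%N ->
  exists v : I -> F, (exists i, v i != 0) /\ \sum_i v i *: Q i = 0.
Proof.
move=> sQ nI; pose A := \matrix_(i < #|I|, j < n) (Q (enum_val i))`_j.
have /rowV0Pn[u /sub_kermxP uA u0] : kermx A != 0.
  rewrite -mxrank_eq0 mxrank_ker subn_eq0 -ltnNge.
  exact: leq_ltn_trans (rank_leq_col A) nI.
exists (fun i => u 0 (enum_rank i)); split.
  have [j uj] : exists j, u 0 j != 0 by apply/rV0Pn.
  by exists (enum_val j); rewrite enum_valK.
apply/polyP => j; rewrite coef0 coef_sum.
have [jn|jn] := ltnP j n; last first.
  by rewrite big1 // => i _; rewrite coefZ nth_default ?mulr0 // (leq_trans (sQ i)).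
have := congr1 (fun B : 'rV_n => B 0 (Ordinal jn)) uA; rewrite !mxE => uAj.
rewrite -[RHS]uAj.
rewrite [RHS](reindex (@enum_rank I)) /=; last by apply: onW_bij; exact: enum_rank_bij.
by apply: eq_bigr => i _; rewrite !mxE enum_rankK coefZ.
Qed.

(** The third hypothesis says that [h] is not a constant multiple of a square.
With [s = t.*2.+1], the product [(b + a h^t) (b - a h^t) h = b^2 h - a^2 h^s] is
congruent to [b^2 h - h(0)^s a^2] modulo [X^s], since [h^s] is a polynomial in
[X^s]; the latter has degree less than [s], so it must vanish. *)
Lemma stepanov_term_neq0 (F : fieldType) (t : nat) (h a b : {poly F}) :
  [pchar F].-nat t.*2.+1 -> h.[0] != 0 ->
  (forall c (a b : {poly F}), c != 0 -> b ^+ 2 * h = c *: a ^+ 2 -> a = 0) ->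
  (size a <= t)%N -> ((size b).*2 + size h <= t.*2.+2)%N ->
  'X^(t.*2.+1) %| b + a * h ^+ t -> a = 0 /\ b = 0.
Proof.
set s := t.*2.+1 => pnat_s h0 nsq sa sb dvd_s.
have h_neq0 : h != 0 by apply: contraNneq h0 => ->; rewrite horner0.
have pnat_sX : [pchar {poly F}].-nat s.
  apply: sub_in_pnat pnat_s => p _; exact: (rmorph_pchar (polyC)).
have [h1 def_h] : exists h1, h = h1 * 'X + h.[0]%:P.
  have /dvdpP[h1 eq_h] : 'X - 0%:P %| h - h.[0]%:P.
    by rewrite dvdp_XsubCl rootE hornerD hornerN hornerC subrr.
  by exists h1; rewrite -[X in _ * X]subr0 -polyC0 -eq_h subrK.
have hs : h ^+ s = h1 ^+ s * 'X^s + (h.[0] ^+ s)%:P.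
  by rewrite {1}def_h exprDn_pchar // exprMn rmorphXn.
have eq_ab : b ^+ 2 * h = h.[0] ^+ s *: a ^+ 2.
  apply/eqP; rewrite -subr_eq0; apply: contraTT (leqnn s) => r0; rewrite -ltnNge.
  have /(dvdp_leq r0) : 'X^s %| b ^+ 2 * h - h.[0] ^+ s *: a ^+ 2.
    have -> : b ^+ 2 * h - h.[0] ^+ s *: a ^+ 2 =
        (b + a * h ^+ t) * (b - a * h ^+ t) * h + a ^+ 2 * h1 ^+ s * 'X^s.
      have -> : a ^+ 2 * h1 ^+ s * 'X^s = a ^+ 2 * (h ^+ s - (h.[0] ^+ s)%:P).
        by rewrite hs addrK mulrA.
      have -> : h ^+ s = h * (h ^+ t * h ^+ t) by rewrite -exprD addnn -exprS.
      by rewrite -mul_polyC; ring.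
    by apply: dvdp_add; [rewrite -mulrA dvdp_mulr | exact: dvdp_mull].
  rewrite size_polyXn => /leq_trans; apply.
  rewrite (leq_trans (size_polyD _ _)) // geq_max size_polyN; apply/andP; split.
    have [->|b0] := eqVneq b 0; first by rewrite expr2 !mul0r size_poly0.
    rewrite size_mul ?expf_neq0 // expr2 size_mul //.
    by move: sb; rewrite /s; move: (size b) (size h) => m n; lia.
  rewrite (leq_trans (size_scale_leq _ _)) // expr2 (leq_trans (size_polyMleq _ _)) //.
  by move: sa; rewrite /s; move: (size a) => n; lia.
have a0 : a = 0 by apply: nsq eq_ab; rewrite expf_neq0.
split=> //; move/eqP: eq_ab; rewrite a0 expr0n scaler0.
by rewrite expr2 !mulf_eq0 (negPf h_neq0) orbF orbb => /eqP.
Qed.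

(** The auxiliary polynomial of the method is nonzero unless all its coefficients
[a j] and [b j] are. *)
Lemma stepanov_sum_neq0 (F : fieldType) (t : nat) (h : {poly F}) :
  [pchar F].-nat t.*2.+1 -> h.[0] != 0 ->
  (forall c (a b : {poly F}), c != 0 -> b ^+ 2 * h = c *: a ^+ 2 -> a = 0) ->
  forall (J : nat) (a b : nat -> {poly F}),
  (forall j, (size (a j) <= t)%N) ->
  (forall j, ((size (b j)).*2 + size h <= t.*2.+2)%N) ->
  \sum_(j < J) 'X^(j * t.*2.+1) * (b j + a j * h ^+ t) = 0 ->
  forall j, (j < J)%N -> a j = 0 /\ b j = 0.
Proof.
move=> pnat_s h0 nsq; set s := t.*2.+1; elim=> // J IHJ a b sa sb.
rewrite big_ord_recl mul0n expr0 mul1r.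
have -> : \sum_(i < J) 'X^(lift ord0 i * s) * (b (lift ord0 i) + a (lift ord0 i) * h ^+ t) =
    'X^s * \sum_(i < J) 'X^(i * s) * (b i.+1 + a i.+1 * h ^+ t).
  rewrite mulr_sumr; apply: eq_bigr => i _.
  by rewrite lift0 mulSn exprD mulrA.
move=> sum0; have [|a0 b0] := stepanov_term_neq0 pnat_s h0 nsq (sa 0%N) (sb 0%N).
  by move/eqP: sum0; rewrite addr_eq0 => /eqP ->; rewrite dvdpNr dvdp_mulr.
case=> [|j] //; rewrite ltnS => jJ.
apply: (IHJ (fun j => a j.+1) (fun j => b j.+1)) => //.
by move/eqP: sum0; rewrite a0 b0 mul0r !add0r mulf_eq0 expf_eq0 polyX_eq0 andbF => /eqP.
Qed.

(** Here [(t * t.+1).*2] is [(#|F| - 1) / 2], so for [e = 1] or [e = -1] this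
bounds the number of [x] where the quadratic character of [h] is [e]. *)
Lemma card_quadratic_symbol_le (F : finFieldType) (t d : nat) (h : {poly F}) (e : F) :
  [pchar F].-nat t.*2.+1 -> #|F| = (t.*2.+1 ^ 2)%N ->
  h.[0] != 0 ->
  (forall c (a b : {poly F}), c != 0 -> b ^+ 2 * h = c *: a ^+ 2 -> a = 0) ->
  (size h <= d.+1)%N -> (d.*2 < t)%N -> e != 0 ->
  (#|[pred x | h.[x] ^+ (t * t.+1).*2 == e]| <= (t * t.+1).*2 + 3 * (t * d))%N.
Proof.
set s := t.*2.+1 => pnat_s cardF h0 nsq sh dt e0.
(* There are [J.+1] values of the index [j], and [B.+1 = t - d] coefficients in
   each of [a_j] and [b_j]. *)
pose J := (t + d)%N; pose B := (t - d).-1.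
pose g : {poly F} := h ^+ t.
pose I := (bool * ('I_J.+1 * 'I_B.+1))%type.
(* [Q (true, (j, k))] and [Q (false, (j, k))] are the contributions of the
   coefficients of degree [k] in [b_j] and [a_j] to [P(x)^s * h(x)^t]. *)
pose Q (i : I) : {poly F} :=
  let: (c, (j, k)) := i in (if c then g else e%:P) * 'X^(j + k * s).
have sg : (size g <= (d * t).+1)%N.
  by rewrite (leq_trans (size_poly_exp_leq _ _)) // ltnS leq_mul2r; move: (size h) sh => n; lia.
pose n := (J + B * s + d * t).+1.
have sQ i : (size (Q i) <= n)%N.
  case: i => c [j k]; rewrite /Q (leq_trans (size_polyMleq _ _)) // size_polyXn addnS /=.
  have : (size (if c then g else e%:P) <= (d * t).+1)%N.
    by case: c => //; rewrite (leq_trans (size_polyC_leq1 _)).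
  have := ltn_ord j; have : (k * s <= B * s)%N by rewrite leq_mul2r -ltnS ltn_ord orbT.
  rewrite /n; move: (size _) (k * s)%N (B * s)%N (d * t)%N => x y z w; lia.
have nI : (n < #|{: I}|)%N.
  rewrite !card_prod card_bool !card_ord /n /J /B /s.
  have [r ->] : exists r, t = (d.*2.+1 + r)%N by exists (t - d.*2.+1)%N; lia.
  have -> : ((d.*2.+1 + r - d).-1 = d + r)%N by lia.
  nia.
have [v [[i0 vi0] sumQ]] := exists_poly_dependence sQ nI.
(* The coefficients are the [s]-th powers of the [v i]; as [z ^ (s ^ 2) = z] in
   [F], their own [s]-th powers are the [v i]. *)
pose w c j k : F := v (c, (inord j, inord k)).
pose a j := \poly_(k < B.+1) w false j k ^+ s.
pose b j := \poly_(k < B.+1) w true j k ^+ s.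
pose P := \sum_(j < J.+1) 'X^(j * s) * (b j + a j * g).
have sa j : (size (a j) <= B.+1)%N by exact: size_poly.
have sb j : (size (b j) <= B.+1)%N by exact: size_poly.
have P0 : P != 0.
  have ab0 := stepanov_sum_neq0 pnat_s h0 nsq (J := J.+1) (a := a) (b := b).
  apply: contra_neq vi0 => /ab0 {}ab0.
  have [j|j|a0 b0] := ab0 _ _ i0.2.1 (ltn_ord _).
  - by rewrite (leq_trans (sa j)) // /B; lia.
  - by move: (sb j) sh; rewrite /B; move: (size _) (size h) => x y; lia.
  have coef0 c : w c i0.2.1 i0.2.2 ^+ s = 0.
    have := congr1 (fun q : {poly F} => q`_i0.2.2) (if c return (if c then b i0.2.1 else a i0.2.1) = 0 then b0 else a0).
    by case: c; rewrite coef_poly ltn_ord coef0.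
  have /eqP := coef0 i0.1; rewrite expf_eq0 => /andP[_ /eqP].
  by rewrite /w !inord_val -!surjective_pairing.
have Proot x : h.[x] ^+ (t * t.+1).*2 == e -> root P x.
  move=> /eqP hx; pose y := h.[x] ^+ t.
  have yys : y * y ^+ s = e.
    by rewrite -exprS -exprM -hx /s; congr (_ ^+ _); lia.
  have y0 : y != 0 by apply: contra_neq e0 => y0; rewrite -yys y0 mul0r.
  have frob (z : F) : (z ^+ s) ^+ s = z by rewrite -exprM mulnn -cardF expf_card.
  have frob_sum n' (f : 'I_n' -> F) : (\sum_i f i) ^+ s = \sum_i f i ^+ s.
    rewrite -[_ ^+ s]/((fun z => z ^+ s) _).
    apply: (big_morph (fun z => z ^+ s)); last by rewrite expr0n.
    by move=> z z'; rewrite exprDn_pchar.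
  have Ps : P.[x] ^+ s * y = (\sum_i v i *: Q i).[x].
    have coord_frob c j : (\poly_(k < B.+1) w c j k ^+ s).[x] ^+ s =
        \sum_(k < B.+1) w c j k * x ^+ (k * s).
      rewrite horner_poly frob_sum; apply: eq_bigr => k _.
      by rewrite exprMn frob exprM.
    have mul_y r u z : r * (u + z * y ^+ s) * y = r * (u * y + z * e).
      by rewrite -yys; ring.
    rewrite horner_sum frob_sum mulr_suml horner_sum.
    transitivity (\sum_c \sum_jk (v (c, jk) *: Q (c, jk)).[x]); last first.
      by rewrite pair_bigA; apply: eq_bigr => -[].
    rewrite big_bool /= -big_split /=.
    transitivity (\sum_j \sum_k
        ((v (true, (j, k)) *: Q (true, (j, k))).[x] +
         (v (false, (j, k)) *: Q (false, (j, k))).[x])); last first.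
      by rewrite pair_bigA; apply: eq_bigr => -[].
    apply: eq_bigr => j _; rewrite hornerM hornerXn hornerD hornerM horner_exp -/y.
    rewrite exprMn exprDn_pchar // exprMn !coord_frob exprM frob.
    rewrite mul_y !mulr_suml -big_split mulr_sumr.
    apply: eq_bigr => k _; rewrite /= !hornerZ !hornerM hornerXn hornerC horner_exp.
    rewrite -/y /w !inord_val exprD; ring.
  move: Ps; rewrite sumQ horner0 => /eqP.
  by rewrite mulf_eq0 (negPf y0) orbF expf_eq0 => /andP[].
have sP : (size P <= J * s + B.+1 + t * d)%N.
  apply: (leq_trans (size_sum _ _ _)); apply/bigmax_leqP => j _.
  rewrite (leq_trans (size_polyMleq _ _)) // size_polyXn /=.
  have sag : (size (b j + a j * g)%R <= B.+1 + t * d)%N.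
    rewrite (leq_trans (size_polyD _ _)) // geq_max; apply/andP; split.
      by rewrite (leq_trans (sb j)) // leq_addr.
    rewrite (leq_trans (size_polyMleq _ _)) //.
    by move: (size _) (size _) (sa j) sg => x y; rewrite mulnC; lia.
  have : (j * s <= J * s)%N by rewrite leq_mul2r -ltnS ltn_ord orbT.
  by move: (size _) sag (j * s)%N (J * s)%N => x y z; lia.
have lt : (#|[pred x | h.[x] ^+ (t * t.+1).*2 == e]| < size P)%N.
  rewrite cardE; apply: (max_poly_roots P0); last exact: enum_uniq.
  by apply/allP => x; rewrite mem_enum inE; exact: Proot.
have := leq_trans lt sP; rewrite /J /B /s; move: #|_| => N.
have [r ->] : exists r, t = (d.*2.+1 + r)%N by exists (t - d.*2.+1)%N; lia.
have -> : ((d.*2.+1 + r - d).-1 = d + r)%N by lia.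
nia.
Qed.

(** * Sums of the quadratic character *)

(** A polynomial with a simple root is not a constant multiple of a square: compare
the parities of the multiplicities of [z]. *)
Lemma simple_root_not_square (F : fieldType) (z : F) (h : {poly F}) :
  ~~ root h z ->
  forall c (a b : {poly F}),
    c != 0 -> b ^+ 2 * (h * ('X - z%:P)) = c *: a ^+ 2 -> a = 0.
Proof.
move=> hz c a b c0 eq_ab; apply/eqP; apply: contraT => a0.
have h0 : h != 0 by apply: contraNneq hz => ->; rewrite root0.
have lin0 : 'X - z%:P != 0 :> {poly F} by rewrite polyXsubC_eq0.
have b0 : b != 0.
  apply: contraNneq a0 => b0; move/eqP: eq_ab.
  by rewrite b0 expr0n mul0r eq_sym scaler_eq0 (negPf c0) expf_eq0.
have mup_lin : mup z ('X - z%:P) = 1%N.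
  by have := mup_XsubCX 1 z z; rewrite expr1 eqxx.
have := congr1 (fun q => odd (mup z q)) eq_ab.
rewrite -mul_polyC !expr2 [mup z (c%:P * _)]mupMr ?rootC // !mupM ?mulf_neq0 //.
by rewrite mup_lin (mupNroot hz) !oddD !addbb.
Qed.

(** The quadratic character of [F] (for [#|F|] odd), given by Euler's criterion: it
is [1] at nonzero squares, [-1] at nonsquares and [0] at [0]. *)
Definition legendre (F : finFieldType) (x : F) : int :=
  (x ^+ #|F|.-1./2 == 1)%:R - (x ^+ #|F|.-1./2 == -1)%:R.


Lemma sqr_odd_double t : (t.*2.+1 ^ 2 = (t * t.+1).*2.*2.+1)%N.
Proof. nia. Qed.

Lemma half_card (F : finFieldType) (t : nat) :
  #|F| = (t.*2.+1 ^ 2)%N -> #|F|.-1./2 = (t * t.+1).*2.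
Proof. by move=> ->; rewrite sqr_odd_double /= doubleK. Qed.

Lemma opp1_neq1 (F : finFieldType) : odd #|F| -> (-1 == 1 :> F) = false.
Proof.
move=> oddF; apply/negP => /eqP N1.
have char2 : 2%N \in [pchar F] by rewrite inE /= mulr2n -{1}N1 addNr.
move: oddF (finNzRing_gt1 F); rewrite (card_pprimeChar char2) oddX /= orbF.
by move=> /eqP ->.
Qed.

Lemma expf_half (F : finFieldType) (x : F) : odd #|F| -> x != 0 ->
  x ^+ #|F|.-1./2 = 1 \/ x ^+ #|F|.-1./2 = -1.
Proof.
move=> oddF x0.
have : (x ^+ #|F|.-1./2) ^+ 2 = 1.
  have c0 : (0 < #|F|)%N by case: #|F| oddF.
  have -> : (x ^+ #|F|.-1./2) ^+ 2 = x ^+ #|F|.-1.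
    rewrite -exprM; congr (_ ^+ _); move: oddF c0; lia.
  by apply: (mulfI x0); rewrite -exprS prednK // expf_card mulr1.
by move/eqP; rewrite sqrf_eq1 => /orP[] /eqP; [left|right].
Qed.

Lemma odd_card_gt2 (F : finFieldType) : odd #|F| -> (2 < #|F|)%N.
Proof. by have := finNzRing_gt1 F; case: #|F| => [|[|[|n]]]. Qed.

Lemma legendre0 (F : finFieldType) : odd #|F| -> legendre (0 : F) = 0.
Proof.
move=> /odd_card_gt2 c2; rewrite /legendre expr0n.
have -> : (#|F|.-1./2 == 0)%N = false by case: #|F| c2 => [|[|[|n]]].
by rewrite eq_sym oner_eq0 eq_sym oppr_eq0 oner_eq0.
Qed.

Lemma legendre1 (F : finFieldType) : odd #|F| -> legendre (1 : F) = 1.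
Proof. by move=> oddF; rewrite /legendre expr1n eqxx eq_sym opp1_neq1. Qed.

Lemma legendreM (F : finFieldType) (x y : F) : odd #|F| ->
  legendre (x * y) = legendre x * legendre y.
Proof.
move=> oddF; have [->|x0] := eqVneq x 0; first by rewrite mul0r legendre0 ?mul0r.
have [->|y0] := eqVneq y 0; first by rewrite mulr0 legendre0 ?mulr0.
have N1 := opp1_neq1 oddF; have N1' : (1 == -1 :> F) = false by rewrite eq_sym.
rewrite /legendre exprMn.
by case: (expf_half oddF x0) => ->; case: (expf_half oddF y0) => ->;
  rewrite ?mulrNN ?mulN1r ?mulrN1 ?mul1r ?opprK ?eqxx ?N1 ?N1'.
Qed.

Lemma legendre_prod (F : finFieldType) (I : finType) (A : {set I}) (f : I -> F) :
  odd #|F| ->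
  legendre (\prod_(i in A) f i) = \prod_(i in A) legendre (f i).
Proof.
move=> oddF; apply: (big_morph (@legendre F)); last exact: legendre1.
by move=> x y; apply: legendreM.
Qed.

Lemma legendre_values (F : finFieldType) (x : F) : odd #|F| -> x != 0 ->
  legendre x = 1 \/ legendre x = -1.
Proof.
move=> oddF x0; have N1 := opp1_neq1 oddF.
rewrite /legendre; case: (expf_half oddF x0) => ->.
  by left; rewrite eqxx eq_sym N1.
by right; rewrite eqxx N1.
Qed.

(** As [#|F|] is the square of an odd number, [-1] is a square in [F]; hence the
arbitrary sign. *)
Lemma legendreN1_not_square (F : finFieldType) (t : nat) (x : F) :
  #|F| = (t.*2.+1 ^ 2)%N -> legendre x = -1 ->
  forall n y, (-1) ^+ n * x != y ^+ 2.
Proof.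
move=> cardF Lx n y; have oddF : odd #|F| by rewrite cardF oddX /= odd_double.
have x0 : x != 0.
  by apply: contra_eq_neq Lx => ->; rewrite legendre0.
have x1 : x ^+ #|F|.-1./2 = -1.
  case: (expf_half oddF x0) => // x1; move: Lx.
  by rewrite /legendre x1 eqxx eq_sym opp1_neq1.
apply/eqP => eq_y; have y0 : y != 0.
  by apply: contra_neq x0 => y0; move/eqP: eq_y;
    rewrite y0 expr0n mulf_eq0 signr_eq0 => /eqP.
have /eqP := congr1 (fun z => z ^+ #|F|.-1./2) eq_y.
have -> : ((-1) ^+ n * x) ^+ #|F|.-1./2 = -1.
  rewrite exprMn x1 -exprM (half_card cardF) -signr_odd oddM odd_double andbF.
  by rewrite mul1r.
rewrite -exprM mulnC exprM.
by case: (expf_half oddF y0) => ->; rewrite ?sqrrN expr1n opp1_neq1.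
Qed.

(** The number of [x] with [legendre h.[x] = 1] and the number of those with
[legendre h.[x] = -1] are both at most [(#|F| - 1) / 2 + 3 t d], and they add up
to at least [#|F| - d]; so they differ by at most [6 t d + d]. *)
Lemma legendre_sum_le (F : finFieldType) (t d : nat) (h : {poly F}) :
  [pchar F].-nat t.*2.+1 -> #|F| = (t.*2.+1 ^ 2)%N ->
  h.[0] != 0 ->
  (forall c (a b : {poly F}), c != 0 -> b ^+ 2 * h = c *: a ^+ 2 -> a = 0) ->
  (size h <= d.+1)%N -> (d.*2 < t)%N ->
  `|\sum_x legendre h.[x]| <= (7 * (t * d))%N%:Z.
Proof.
move=> pnat_s cardF h0 nsq sh dt.
have oddF : odd #|F| by rewrite cardF oddX /= odd_double.
pose n e := #|[pred x | h.[x] ^+ #|F|.-1./2 == e]|.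
have n_le e : e != 0 -> (n e <= (t * t.+1).*2 + 3 * (t * d))%N.
  by rewrite /n (half_card cardF); exact: card_quadratic_symbol_le.
have n1 := n_le 1 (oner_neq0 F).
have nN : (n (-1)%R <= (t * t.+1).*2 + 3 * (t * d))%N.
  by apply: n_le; rewrite oppr_eq0 oner_neq0.
have h_neq0 : h != 0 by apply: contraNneq h0 => ->; rewrite horner0.
have nZ : (#|[pred x | root h x]| <= d)%N.
  rewrite -ltnS; apply: leq_trans sh; rewrite cardE.
  apply: (max_poly_roots h_neq0); last exact: enum_uniq.
  by apply/allP => x; rewrite mem_enum inE.
have sum_n e : \sum_x (h.[x] ^+ #|F|.-1./2 == e)%:R = (n e)%:R :> int.
  rewrite /n; move: #|F|.-1./2 => m.
  by rewrite -natr_sum -sum1_card [in RHS]big_mkcond; congr (_%:R).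
rewrite /legendre sumrB !sum_n.
have cover : (#|F| <= n 1%R + n (-1)%R + #|[pred x | root h x]|)%N.
  have half x : h.[x] != 0 ->
    (h.[x] ^+ #|F|.-1./2 == 1) || (h.[x] ^+ #|F|.-1./2 == -1).
    by move=> hx0; case: (expf_half oddF hx0) => ->; rewrite eqxx ?orbT.
  rewrite /n; move: #|F|.-1./2 half => m half.
  rewrite -!sum1_card !(big_mkcond (fun x => x \in _)) -!big_split.
  apply: leq_sum => x _; rewrite !inE rootE.
  by have [->|/half /orP[->|->]] := eqVneq h.[x] 0; rewrite /= ?addnA ?addn0 ?addn1.
rewrite cardF sqr_odd_double in cover.
have td_ge : (d <= t * d)%N by nia.
move: cover n1 nN nZ td_ge; move: (n 1) (n (-1)) #|_| => x y z.
move: ((t * t.+1).*2)%N (t * d)%N => T td; rewrite !natz ler_norml; lia.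
Qed.

(** * Simultaneous nonsquare translates *)

Lemma legendre_sum_translates_le (F : finFieldType) (t : nat) (I : finType)
    (a : I -> F) (A : {set I}) :
  [pchar F].-nat t.*2.+1 -> #|F| = (t.*2.+1 ^ 2)%N ->
  injective a -> A != finset.set0 -> (#|I|.*2 < t)%N -> (#|I| < #|F|)%N ->
  `|\sum_x \prod_(i in A) legendre (x + a i)| <= (7 * (t * #|I|))%N%:Z.
Proof.
move=> pnat_s cardF a_inj A0 It IF.
have oddF : odd #|F| by rewrite cardF oddX /= odd_double.
(* Translating by [y] ensures that the polynomial does not vanish at [0]. *)
have [y y_out] : exists y, y \notin [set - a i | i : I].
  apply/existsP; rewrite -negb_forall; apply: contraL IF => /forallP all_in.
  rewrite -leqNgt; apply: leq_trans (leq_imset_card (fun i => - a i) I).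
  by apply/subset_leq_card/fintype.subsetP => x _; exact: all_in.
pose h := \prod_(i in A) ('X + (y + a i)%:P).
have hE x : h.[x] = \prod_(i in A) (x + y + a i).
  by rewrite horner_prod; apply: eq_bigr => i _; rewrite hornerD hornerX hornerC addrA.
have -> : \sum_x \prod_(i in A) legendre (x + a i) = \sum_x legendre h.[x].
  rewrite (reindex_inj (addIr y)); apply: eq_bigr => x _.
  by rewrite hE legendre_prod.
apply: legendre_sum_le => //.
- rewrite hE; apply/prodf_neq0 => i _; rewrite add0r.
  by apply: contra y_out; rewrite addr_eq0 => /eqP->; exact: imset_f.
- have /finset.set0Pn[i iA] := A0.
  rewrite /h (bigD1 i) //= mulrC.
  have -> : (y + a i)%:P = - (- (y + a i))%:P :> {poly F} by rewrite polyCN opprK.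
  apply: simple_root_not_square; rewrite rootE horner_prod.
  apply/prodf_neq0 => j /andP[_ ji]; rewrite hornerD hornerX hornerC.
  by rewrite addrC subr_eq0 (inj_eq (addrI y)) (inj_eq a_inj).
- apply: (leq_trans (size_poly_prod_leq _ _)).
  under eq_bigr do rewrite size_XaddC.
  rewrite sum_nat_const -[#|in_mem^~ _|]/#|A|.
  have := max_card (mem A); move: #|A| #|I| => m n; rewrite muln2; lia.
Qed.

(** If every [x] had a translate [x + i] with quadratic character [1] or [0], the
product [prodc x] below would vanish unless [x + i = 0] for some [i],
and its sum over [x] would be at most [p * 2 ^ p]. *)
Lemma exists_translates_legendreN1 (F : finFieldType) (p t : nat) :
  p \in [pchar F] -> [pchar F].-nat t.*2.+1 -> #|F| = (t.*2.+1 ^ 2)%N ->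
  (2 * (p * 2 ^ p) <= t)%N ->
  exists c : F, forall i : nat, legendre (c + i%:R) = -1.
Proof.
move=> charp pnat_s cardF le_t.
have oddF : odd #|F| by rewrite cardF oddX /= odd_double.
have p_gt1 : (1 < p)%N by rewrite prime_gt1 ?(pcharf_prime charp).
have le_2p : (p <= 2 ^ p)%N by rewrite ltnW // ltn_expl.
have ltpt : (p.*2 < t)%N by nia.
have ltpF : (p < #|F|)%N by rewrite cardF -mulnn; nia.
pose prodc (x : F) := \prod_(i < p) (1 - legendre (x + i%:R) : int).
have sum_ge : #|F|%:R - (2 ^ p * (7 * (t * p)))%N%:R <= \sum_x prodc x :> int.
  have -> : \sum_x prodc x =
      \sum_(A : {set 'I_p}) (-1) ^+ #|A| * \sum_(x : F) \prod_(i in A) legendre (x + i%:R).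
    have prodcE x : prodc x =
        \sum_(A : {set 'I_p}) (-1) ^+ #|A| * \prod_(i in A) legendre (x + i%:R).
      rewrite /prodc; under eq_bigr do rewrite addrC.
      rewrite bigA_distr; apply: eq_bigr => A _.
      by rewrite -big_mkcond prodrN.
    under eq_bigr do rewrite prodcE.
    by rewrite exchange_big; apply: eq_bigr => A _; rewrite mulr_sumr.
  rewrite (bigD1 finset.set0) //= cards0 expr0 mul1r.
  under eq_bigr do rewrite big_set0.
  rewrite sumr_const; apply: lerD => //.
  apply: (@le_trans _ _ (\sum_(A : {set 'I_p} | A != finset.set0) - (7 * (t * p))%N%:Z)).
    have -> : - (2 ^ p * (7 * (t * p)))%N%:R =
        \sum_(A : {set 'I_p}) - (7 * (t * p))%N%:Z :> int.
      rewrite sumr_const -finset.cardsT -finset.powersetT finset.card_powerset.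
      by rewrite finset.cardsT card_ord natz PoszM mulNrn -mulr_natr natz mulrC.
    by rewrite (bigD1 finset.set0) //= gerDr oppr_le0.
  apply: ler_sum => A A0.
  have := @legendre_sum_translates_le F t 'I_p (fun i => i%:R) A pnat_s cardF.
  rewrite card_ord => /(_ _ A0 ltpt ltpF); rewrite ler_norml => bound.
  have /bound : injective (fun i : 'I_p => i%:R : F).
    by move=> i j /(natr_inj_pchar charp (ltn_ord i) (ltn_ord j))/val_inj.
  move: (\sum_x _) (7 * (t * p))%N => S B.
  by rewrite -signr_odd; case: odd; rewrite ?expr1 ?expr0 ?mulN1r ?mul1r; lia.
have [c prodc_gt] : exists c : F, (prodc c > \sum_(i < p) (c == - i%:R)%:R * 2 ^+ p).
  apply/existsP; apply: contraT; rewrite negb_exists => /forallP prodc_le.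
  have : \sum_x prodc x <= \sum_(x : F) \sum_(i < p) (x == - i%:R)%:R * 2 ^+ p.
    by apply: ler_sum => x _; rewrite leNgt.
  rewrite exchange_big /=.
  have -> : \sum_(i < p) \sum_(x : F) (x == - i%:R)%:R * 2 ^+ p = (p * 2 ^ p)%N%:R :> int.
    rewrite -[X in (X * _)%N]card_ord natrM natrX -sum1_card natr_sum mulr_suml.
    apply: eq_bigr => i _; rewrite -mulr_suml; congr (_ * _).
    by rewrite (bigD1 (- i%:R)) //= eqxx big1 ?addr0 // => x /negPf ->.
  move=> sum_le; have := le_trans sum_ge sum_le.
  rewrite cardF !natz; move: (2 ^ p)%N le_t le_2p => P le_t le_2p.
  have : (p * P + P * (7 * (t * p)) < t.*2.+1 ^ 2)%N by rewrite -mulnn; nia.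
  lia.
have factor_ge0 (x : F) : 0 <= 1 - legendre x :> int.
  have [->|x0] := eqVneq x 0; first by rewrite legendre0.
  by case: (legendre_values oddF x0) => ->.
have factor_le2 (x : F) : 1 - legendre x <= 2 :> int.
  have [->|x0] := eqVneq x 0; first by rewrite legendre0.
  by case: (legendre_values oddF x0) => ->.
exists c => i.
rewrite -(GRing.natr_mod_pchar charp); have ip := ltn_pmod i (ltnW p_gt1).
move: (i %% p)%N ip => {}i ip; pose i' := Ordinal ip.
have c_i0 : c + i%:R != 0.
  apply: contraTneq prodc_gt => /eqP; rewrite addr_eq0 => c_i; rewrite -leNgt.
  rewrite (bigD1 i') //= c_i mul1r (le_trans (y := 2 ^+ p)) //.
    rewrite -[X in _ ^+ X]card_ord -prodr_const; apply: ler_prod => j _.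
    by rewrite factor_ge0 factor_le2.
  by rewrite lerDl sumr_ge0 // => j _; rewrite mulr_ge0 ?ler0n ?exprn_ge0.
case: (legendre_values oddF c_i0) => // L1; move: prodc_gt.
rewrite /prodc [in X in _ < X](bigD1 i') //= L1 subrr mul0r => /lt_geF/negP[].
by rewrite sumr_ge0 // => j _; rewrite mulr_ge0 ?ler0n ?exprn_ge0.
Qed.

(** * Numerical estimates *)

(** Any constant less than [sqrt 2 / 2] would do. This one is [32] times
[22 / 1000], so [1022 / 1000] has to be squared five times. *)
Lemma ln2_le (R : realType) : ln 2 <= 704 / 1000 :> R.
Proof.
rewrite -[leRHS]expRK ler_ln ?posrE ?expR_gt0 //.
have -> : 704 / 1000 =
    2%:R * (2%:R * (2%:R * (2%:R * (2%:R * (22 / 1000))))) :> R by lra.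
rewrite 5!expRM_natl.
have sq (a b x : R) : 0 <= a -> b <= a ^+ 2 -> a <= x -> b <= x ^+ 2.
  by move=> a0 ba ax; apply: (le_trans ba); rewrite lerXn2r ?nnegrE // (le_trans a0).
apply: (sq (14151 / 10000)); [lra|rewrite expr2; lra|].
apply: (sq (11896 / 10000)); [lra|rewrite expr2; lra|].
apply: (sq (10907 / 10000)); [lra|rewrite expr2; lra|].
apply: (sq (10444 / 10000)); [lra|rewrite expr2; lra|].
apply: (sq (1022 / 1000)); [lra|rewrite expr2; lra|].
by apply: le_trans (expR_ge1Dx _); lra.
Qed.

Lemma ln_power_bound (R : realType) : exists N : nat, forall p s : nat,
  (N <= p)%N -> (0 < s)%N -> (s <= 5 * p ^ 2 * 2 ^ p)%N ->
  1 / 2 * ln ((s ^ 2)%N%:R : R) ^+ 2 <= (p ^ 2)%N%:R.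
Proof.
(* From [p >= 2 * 10^9] on, [5 p^2] is at most [x^3 / 6], where
   [x = 3 p / 1000]. *)
exists (Num.bound (2 * (1000 * (1000 * 1000)) : R)) => p s Np s0 sle.
have p_ge : 2 * (1000 * (1000 * 1000)) <= p%:R :> R.
  have b0 : 0 <= 2 * (1000 * (1000 * 1000)) :> R by lra.
  by rewrite (le_trans (ltW (archi_boundP b0))) // ler_nat.
have p0 : 0 < p%:R :> R by lra.
have s_gt0 : 0 < s%:R :> R by rewrite ltr0n.
have lnp : ln (5 * p%:R ^+ 2) <= 3 / 1000 * p%:R :> R.
  rewrite -[leRHS]expRK ler_ln ?posrE ?expR_gt0 ?mulr_gt0 ?exprn_gt0 //.
  have x0 : 0 <= 3 / 1000 * p%:R :> R by lra.
  apply: le_trans (expR_ge1Dxn 2 x0).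
  have -> : 3`!%:R = 6 :> R by [].
  nra.
(* The square of [707 / 1000] is less than [1 / 2]. *)
have ln_s : ln s%:R <= 707 / 1000 * p%:R :> R.
  have : ln s%:R <= ln (5 * p%:R ^+ 2 * 2 ^+ p) :> R.
    rewrite ler_ln ?posrE ?mulr_gt0 ?exprn_gt0 //.
    by move: sle; rewrite -(ler_nat R) !natrM !natrX.
  rewrite lnM ?posrE ?mulr_gt0 ?exprn_gt0 // lnXn // -mulr_natr.
  have := ln2_le R; nra.
have ln_s0 : 0 <= ln s%:R :> R by rewrite ln_ge0 // ler1n.
by rewrite natrX lnXn // natrX -mulr_natr; nra.
Qed.

(** * The lower bound for infinitely many fields *)

Lemma square_le_M (F : finFieldType) (p k : nat) :
  p \in [pchar F] -> odd p -> #|F| = ((p ^ k) ^ 2)%N ->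
  (5 * (p * 2 ^ p) <= p ^ k)%N -> (p ^ 2 <= M F)%N.
Proof.
move=> charp oddp cardF le_pk.
have p_pr := pcharf_prime charp.
have s_odd : (p ^ k = (p ^ k)./2.*2.+1)%N.
  by rewrite -[LHS]odd_double_half oddX oddp orbT.
have cardF' : #|F| = ((p ^ k)./2.*2.+1 ^ 2)%N by rewrite -s_odd.
have pnat_s : [pchar F].-nat (p ^ k)./2.*2.+1.
  rewrite -s_odd pnatX; apply/orP; left.
  by rewrite (eq_pnat _ (pcharf_eq charp)) pnat_id.
have le_t : (2 * (p * 2 ^ p) <= (p ^ k)./2)%N.
  have : (0 < p * 2 ^ p)%N by rewrite muln_gt0 prime_gt0 ?expn_gt0.
  by move: (p ^ k)%N (p * 2 ^ p)%N le_pk => x y; lia.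
have [c Lc] := exists_translates_legendreN1 charp pnat_s cardF' le_t.
apply: (le_M_nonsquare_translates (c := c) charp oddp) => i n y.
exact: legendreN1_not_square cardF' (Lc i) n y.
Qed.

Lemma infinite_set_nat (A : set nat) :
  (forall m, exists2 q, (m < q)%N & A q) -> infinite_set A.
Proof.
move=> unbounded /finite_fsetP[X AX].
have [q lt_q] := unbounded (\max_(x <- X) x)%N; rewrite AX /= => qX.
by move: lt_q; rewrite ltnNge => /negP; apply; exact: leq_bigmax_seq.
Qed.

Local Open Scope classical_set_scope.
Local Open Scope ring_scope.

Theorem theorem2 (R : realType) :
  infinite_set [set q : nat | exists F : finFieldType,
    #|F| = q /\ 1 / 2 * (ln (q%:R : R)) ^+ 2 <= (M F)%:R].
Proof.
have [N bound] := ln_power_bound R.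
apply: infinite_set_nat => m.
have [p p_gt p_pr] := prime_above (maxn (maxn N m) 2).
move: p_gt; rewrite !gtn_max -andbA => /and3P[Np mp p_gt2].
have oddp : odd p by case: (even_prime p_pr) p_gt2 => [->|].
have p_gt1 := prime_gt1 p_pr.
pose x := (5 * (p * 2 ^ p))%N; pose k := up_log p x.
have x_gt1 : (1 < x)%N.
  by rewrite /x; have := expn_gt0 2 p; move: (2 ^ p)%N => y; nia.
have k_gt0 : (0 < k)%N by rewrite up_log_gt0 p_gt1.
have k2_gt0 : (0 < k * 2)%N by rewrite muln_gt0 k_gt0.
have [F charp cardF] := pPrimePowerField p_pr k2_gt0.
rewrite expnM in cardF.
have p_le_pk : (p <= p ^ k)%N by rewrite -[X in (X <= _)%N]expn1 leq_pexp2l // prime_gt0.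
exists ((p ^ k) ^ 2)%N.
  by rewrite -mulnn (leq_trans mp) // (leq_trans p_le_pk) // leq_pmulr // expn_gt0 prime_gt0.
exists F; split=> //.
have le_M := square_le_M charp oddp cardF (up_logP x p_gt1).
have le_pk : (p ^ k <= 5 * p ^ 2 * 2 ^ p)%N.
  have := up_log_gtn p_gt1 x_gt1; rewrite -/k => lt_x.
  have -> : (5 * p ^ 2 * 2 ^ p = p * x)%N by rewrite /x -mulnn; ring.
  by rewrite -(prednK k_gt0) expnS leq_mul2l ltnW ?orbT.
apply: (le_trans (bound p (p ^ k)%N (ltnW Np) _ le_pk)).
  by rewrite expn_gt0 prime_gt0.
by rewrite ler_nat.
Qed.
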